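(* Let $\mathcal{H}$ be a Hilbert space. Let $H:\mathcal{H}\to\mathcal{H}$ be strongly monotone with constant $\gamma>0$ and Lipschitz continuous with constant $\tau>0$. Let $A:\mathcal{H}\to\mathcal{H}$ be Lipschitz continuous with constant $s>0$ and strongly monotone with respect to $H$ with constant $r>0$. Let $M:\mathcal{H}\to 2^{\mathcal{H}}$ be a strongly $H$-monotone operator with constant $\eta>0$. Let $\lambda>0$ be a constant such that $$\left|\lambda-\frac{r+\gamma\eta}{s^2-\eta^2}\right|<\frac{\sqrt{(r+\gamma\eta)^2-(s^2-\eta^2)(\tau^2-\gamma^2)}}{s^2-\eta^2},\qquad (r+\gamma\eta)^2>(s^2-\eta^2)(\tau^2-\gamma^2),\qquad s>\eta,$$ put $\kappa=\frac{1}{\gamma+\lambda\eta}\sqrt{\tau^2-2\lambda r+\lambda^2s^2}$, and let $x^*\in\mathcal{H}$ be the unique solution of the problem: find $u\in\mathcal{H}$ such that $0\in A(u)+M(u)$. Let $\{\xi_n\}_{n\ge0},\{\mu_n\}_{n\ge0}\subset[0,1]$ be real sequences with $\sum_{n=0}^{\infty}\xi_n\mu_n(1-\kappa)=\infty$. Let $q_0,s_0\in\mathcal{H}$ and define for all $n\in\mathbb{N}$ $$r_n=(1-\mu_n)q_n+\mu_nR^{H}_{M,\lambda}[Hq_n-\lambda Aq_n],\qquad q_{n+1}=(1-\xi_n)q_n+\xi_nR^{H}_{M,\lambda}[Hr_n-\lambda Ar_n],$$ $$t_n=(1-\mu_n)s_n+\mu_n R^{H}_{M,\lambda}[Hs_n-\lambda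 As_n],\qquad s_{n+1}=R^{H}_{M,\lambda}[Ht_n-\lambda At_n].$$ Then the following are equivalent: (i) $\{q_n\}$ converges strongly to $x^*$; (ii) $\{s_n\}$ converges strongly to $x^*$.
   Context: $\mathbb{N}=\{0,1,2,\dots\}$; $2^{\mathcal{H}}$ is the family of all nonempty subsets of $\mathcal{H}$; $\langle\cdot,\cdot\rangle$ and $\|\cdot\|$ are the inner product and norm of $\mathcal{H}$. An operator $T:\mathcal{H}\to\mathcal{H}$ is strongly monotone with constant $c>0$ if $\langle Tx-Ty,x-y\rangle\ge c\|x-y\|^2$ for all $x,y\in\mathcal{H}$; it is strongly monotone with respect to $H:\mathcal{H}\to\mathcal{H}$ with constant $c>0$ if $\langle Tx-Ty,Hx-Hy\rangle\ge c\|x-y\|^2$ for all $x,y\in\mathcal{H}$; it is Lipschitz continuous with constant $c>0$ if $\|Tx-Ty\|\le c\|x-y\|$ for all $x,y\in\mathcal{H}$. A multivalued operator $M:\mathcal{H}\to 2^{\mathcal{H}}$ is strongly monotone with constant $\eta>0$ if $\langle x-y,u-v\rangle\ge\eta\|u-v\|^2$ for all $u,v\in\mathcal{H}$, $x\in Mu$, $y\in Mv$. It is strongly $H$-monotone (with constant $\eta$) if it is strongly monotone (with constant $\eta$) and $(H+\lambda M)(\mathcal{H})=\mathcal{H}$ for all $\lambda>0$. The resolvent operator $R^{H}_{M,\lambda}:\mathcal{H}\to\mathcal{H}$ is $R^{H}_{M,\lambda}(u)=(H+\lambda M)^{-1}(u)$; it is a well-defined single-valued map when $H$ is continuous and strongly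 monotone and $M$ is strongly $H$-monotone. Under the stated hypotheses the problem $0\in A(u)+M(u)$ has a unique solution. The vectors $r_n\in\mathcal{H}$ and $s_n\in\mathcal{H}$ are not to be confused with the constants $r$ and $s$. *)

(* Defs.v *)
From mathcomp Require Export all_boot all_order all_algebra.
From mathcomp Require Export sesquilinear.
From mathcomp Require Export all_classical all_reals all_analysis.
Export Order.TTheory GRing.Theory Num.Theory.
Export numFieldNormedType.Exports.

Set Implicit Arguments.
Unset Strict Implicit.
Unset Printing Implicit Defensive.

Global Open Scope classical_set_scope.
Global Open Scope ring_scope.

(* A real Hilbert space is a complete normed module V over R together with an
   inner product dot, i.e. a positive definite symmetric bilinear form, that
   induces the norm of V. *)
Definition induces_norm (R : realType) (V : normedModType R)
    (dot : {dot V for idfun}) : Prop :=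
  forall x : V, `|x| = Num.sqrt (dot x x).

Section Operators.
Context {R : realType} {V : normedModType R} (dot : {dot V for idfun}).
Implicit Types (T H : V -> V) (M : V -> set V) (c eta lam : R).

Definition strongly_monotone_wrt T H c : Prop :=
  forall x y, c * `|x - y| ^+ 2 <= dot (T x - T y) (H x - H y).

Definition strongly_monotone T c : Prop :=
  forall x y, c * `|x - y| ^+ 2 <= dot (T x - T y) (x - y).

Definition mv_strongly_monotone M eta : Prop :=
  forall u v x y, M u x -> M v y -> eta * `|u - v| ^+ 2 <= dot (x - y) (u - v).

Definition mv_add_scale H lam M : V -> set V :=
  fun u => [set H u + lam *: x | x in M u].

Definition strongly_H_monotone H M eta : Prop :=
  mv_strongly_monotone M eta /\
  forall lam, 0 < lam -> \bigcup_u mv_add_scale H lam M u = setT.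

(* The set (H + lam M)^-1 u is a singleton under the usual hypotheses on H and M
   (resolventP and resolvent_uniq below), and [get] returns its element. *)
Definition resolvent H M lam : V -> V :=
  fun u => get [set v | mv_add_scale H lam M v u].

Definition inclusion_solution (A : V -> V) M (u : V) : Prop :=
  [set A u + x | x in M u] 0.

Lemma mv_add_scale_inj H M gamma eta lam :
  0 < gamma -> 0 < eta -> 0 < lam ->
  strongly_monotone H gamma -> mv_strongly_monotone M eta ->
  forall u v w, mv_add_scale H lam M v u -> mv_add_scale H lam M w u -> v = w.
Proof.
move=> gamma0 eta0 lam0 Hg Mg u v w [x Mx xu] [y My yu].
have e : H v - H w = - lam *: (x - y).
  have: H v + lam *: x = H w + lam *: y by rewrite xu yu.
  move/(congr1 (fun z => z - lam *: x - H w)); rewrite addrK => ->.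
  by rewrite scaleNr scalerBr opprB [_ + _ *: y]addrC -!addrA; congr (_ + _);
     rewrite addrCA subrr addr0.
have := Hg v w; have := Mg v w x y Mx My.
rewrite e linearZl_LR /= mulNr.
have [-> //|nvw] := eqVneq v w.
have p : 0 < `|v - w| ^+ 2 by rewrite exprn_gt0// normr_gt0 subr_eq0.
move=> h1 h2; have := lt_le_trans (mulr_gt0 gamma0 p) h2.
rewrite oppr_gt0 pmulr_rlt0 // => /(le_lt_trans h1).
by rewrite pmulr_rlt0 // => /(lt_trans p); rewrite ltxx.
Qed.

Lemma resolventP H M eta lam u :
  0 < lam -> strongly_H_monotone H M eta ->
  mv_add_scale H lam M (resolvent H M lam u) u.
Proof.
move=> lam0 [_ /(_ lam lam0) surj]; rewrite /resolvent.
have [v _ hv] : (\bigcup_u mv_add_scale H lam M u) u by rewrite surj.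
exact: (@getI _ [set v | mv_add_scale H lam M v u] v).
Qed.

Lemma resolvent_uniq H M gamma eta lam u v :
  0 < gamma -> 0 < eta -> 0 < lam ->
  strongly_monotone H gamma -> strongly_H_monotone H M eta ->
  mv_add_scale H lam M v u -> resolvent H M lam u = v.
Proof.
move=> gamma0 eta0 lam0 Hg MH hv.
by apply: (mv_add_scale_inj gamma0 eta0 lam0 Hg MH.1 (resolventP _ lam0 MH) hv).
Qed.

End Operators.

(* Main.v *)
Require Import Defs.
From mathcomp Require Import ring lra.

Set Implicit Arguments.
Unset Strict Implicit.
Unset Printing Implicit Defensive.

(** One step of both schemes is built from the map
    [F u = R (H u - lam A u)], where [R] is the resolvent, and [F] is a
    contraction with constant [kappa < 1] whose fixed point is [xstar].  The
    contraction constant is a product: the forward map [H - lam A] is Lipschitz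
    with constant [sqrt (tau^2 - 2 lam r + lam^2 s^2)] (expand the square,
    lemma [forward_step_lip]), and the resolvent is Lipschitz with constant
    [1 / (gamma + lam eta)] because [H + lam M] is strongly monotone with
    constant [gamma + lam eta] (lemma [resolvent_lip]).  The condition on [lam]
    says precisely that [lam] lies strictly between the roots of the quadratic
    polynomial whose negativity is [kappa < 1] (lemma [contraction_const_lt1]).

    Averaging with weight [mu] towards [F] shrinks the distance to [xstar] by
    the factor [1 - mu (1 - kappa)].  The rest of a step is nonexpansive around
    [xstar], and is itself averaged with weight [xi] in the first scheme, so
    in both schemes the distance [d n] to [xstar] satisfies
    [d (n + 1) <= (1 - xi n * mu n * (1 - kappa)) * d n].
    As the sum of the numbers [xi n * mu n * (1 - kappa)] diverges, this forces
    [d n] to tend to 0 (lemma [cvg0_of_divergent_decrease]).  Hence both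
    sequences converge to [xstar] whatever their starting points, which is
    stronger than the equivalence of their convergence. *)

(** * Real sequences and constants *)

Section RealEstimates.
Context {R : realType}.
Implicit Types (c d : nat -> R) (gamma tau s r eta lam : R).

(** With [S n] the partial sums of [c], the quantity [(1 + S n) d n] does not
    increase, because [(1 + S + c) (1 - c) <= 1 + S] when [S] and [c] are
    nonnegative.  Hence [d n <= d 0 / (1 + S n)]. *)
Lemma cvg0_of_divergent_decrease c d :
  (forall n, 0 <= c n) -> (forall n, 0 <= d n) ->
  (forall n, d n.+1 <= (1 - c n) * d n) ->
  series c @ \oo --> +oo -> d @ \oo --> 0.
Proof.
move=> c0 d0 dS Soo.
have S0 n : 0 <= series c n by rewrite seriesEnat; apply: sumr_ge0.
have bound n : (1 + series c n) * d n <= d 0%N.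
  elim: n => [|n IHn].
    by rewrite seriesEnat/= big_geq// addr0 mul1r.
  apply: le_trans IHn; rewrite seriesEnat/= big_nat_recr//=.
  rewrite -[\sum_(_ <= _ < _) _]/(series c n).
  have := S0 n; have := c0 n; have := d0 n; have := dS n.
  move: (series c n) (c n) (d n) (d n.+1) => S x y z zle y0 x0 S0'.
  have S1 : 0 <= 1 + (S + x) by lra.
  apply: le_trans (ler_wpM2l S1 zle) _.
  by rewrite mulrA; apply: ler_wpM2r => //; nra.
have S1oo : (1 + series c n)^-1 @[n --> \oo] --> (0 : R).
  apply/gtr0_cvgV0; first by apply: nearW => n; rewrite ltr_wpDr.
  move/cvgryPge: Soo => Soo; apply/cvgryPge => A.
  near=> n; apply: (@le_trans _ _ (series c n)); last by rewrite lerDr.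
  by near: n; apply: Soo.
apply: (@squeeze_cvgr _ _ _ _ (fun=> 0) (fun n => d 0%N * (1 + series c n)^-1)).
- by apply: nearW => n; rewrite d0/= ler_pdivlMr ?ltr_wpDr// mulrC.
- exact: cvg_cst.
- by rewrite -[X in _ --> X](mulr0 (d 0%N)); apply: cvgMr.
Unshelve. all: by end_near. Qed.

(** Squaring either inequality, the bound on [lam] or the conclusion, gives that
    the quadratic polynomial
    [(s^2 - eta^2) lam^2 - 2 (r + gamma eta) lam + (tau^2 - gamma^2)]
    is negative at [lam]. *)
Lemma contraction_const_lt1 gamma tau s r eta lam :
  0 < gamma -> 0 < eta -> 0 < lam -> eta < s ->
  `|lam - (r + gamma * eta) / (s ^+ 2 - eta ^+ 2)|
    < Num.sqrt ((r + gamma * eta) ^+ 2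
                - (s ^+ 2 - eta ^+ 2) * (tau ^+ 2 - gamma ^+ 2))
      / (s ^+ 2 - eta ^+ 2) ->
  (gamma + lam * eta)^-1
    * Num.sqrt (tau ^+ 2 - 2 * lam * r + lam ^+ 2 * s ^+ 2) < 1.
Proof.
move=> gamma0 eta0 lam0 etas.
set D := s ^+ 2 - eta ^+ 2; set B := r + gamma * eta; set Q := B ^+ 2 - _.
have D0 : 0 < D by rewrite /D; nra.
rewrite ltr_pdivlMr// -[X in _ * X < _](gtr0_norm D0) -normrM.
rewrite mulrBl divfK ?gt_eqF// => lamQ.
have Q0 : 0 < Q by rewrite -sqrtr_gt0; apply: le_lt_trans lamQ.
have {}lamQ : (lam * D - B) ^+ 2 < Q.
  rewrite -real_normK ?num_real// -[X in _ < X](sqr_sqrtr (ltW Q0)).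
  by rewrite ltr_pXn2r ?nnegrE ?sqrtr_ge0.
have quad : D * lam ^+ 2 - 2 * B * lam + (tau ^+ 2 - gamma ^+ 2) < 0.
  rewrite -(pmulr_rlt0 _ D0); move: lamQ; rewrite /Q; lra.
have g0 : 0 < gamma + lam * eta by rewrite addr_gt0// mulr_gt0.
rewrite mulrC ltr_pdivrMr// mul1r -[ltRHS](gtr0_norm g0) -sqrtr_sqr.
rewrite ltr_sqrt ?exprn_gt0//.
by move: quad; rewrite /D /B; lra.
Qed.

End RealEstimates.

(** * The contraction *)

Section Contraction.
Context {R : realType} {V : normedModType R} (dot : {dot V for idfun}).
Hypothesis hdot : induces_norm dot.
Implicit Types (H A F : V -> V) (M : V -> set V) (u v x y z p : V).
Implicit Types (gamma tau s r eta lam k a : R).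

Lemma dotvv_sqr_norm x : dot x x = `|x| ^+ 2.
Proof.
have [->|x0] := eqVneq x 0; first by rewrite linear0r normr0 expr0n.
by rewrite hdot sqr_sqrtr// ltW// neq0_dnorm_gt0.
Qed.

Lemma dot_sym x y : dot x y = dot y x.
Proof. by rewrite hermC/= expr0 mul1r. Qed.

Lemma sqr_normD x y : `|x + y| ^+ 2 = `|x| ^+ 2 + 2 * dot x y + `|y| ^+ 2.
Proof.
rewrite -!dotvv_sqr_norm linearDl linearD/= linearD/= (dot_sym y x).
by ring.
Qed.

(** Since the norm is already known to satisfy the triangle inequality, the
    Cauchy-Schwarz inequality follows by squaring it. *)
Lemma dot_le_normM x y : dot x y <= `|x| * `|y|.
Proof.
have := ler_normD x y; have := normr_ge0 (x + y); have := sqr_normD x y.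
by move: `|x + y| `|x| `|y| (dot x y) => c a b e; nra.
Qed.

(** The operator [H + lam M] is strongly monotone with constant
    [gamma + lam * eta], and Cauchy-Schwarz turns strong monotonicity of an
    operator into a Lipschitz estimate for its inverse. *)
Lemma resolvent_lip H M gamma eta lam u v :
  0 < lam -> strongly_monotone dot H gamma -> strongly_H_monotone dot H M eta ->
  (gamma + lam * eta) * `|resolvent H M lam u - resolvent H M lam v|
    <= `|u - v|.
Proof.
move=> lam0 Hmon MH.
have := resolventP u lam0 MH; have := resolventP v lam0 MH.
move: (resolvent H M lam u) (resolvent H M lam v) => a b [y My <-] [x Mx <-].
have [->|ab0] := eqVneq (a - b) 0; first by rewrite normr0 mulr0 normr_ge0.
have := Hmon a b; have := MH.1 _ _ _ _ Mx My.
set w := _ - (H b + _).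
have wE : w = (H a - H b) + lam *: (x - y).
  by rewrite /w scalerBr opprD addrACA.
have := dot_le_normM w (a - b); rewrite {1}wE linearDl/= linearZl_LR/=.
have := normr_ge0 w.
have : 0 < `|a - b| by rewrite normr_gt0.
move: `|a - b| `|w| (dot (H a - H b) _) (dot (x - y) _) => n m e f.
move=> n0 m0 efm fn en; rewrite -(ler_pM2r n0).
by apply: le_trans efm; have := ler_wpM2l (ltW lam0) fn; nra.
Qed.

(** Strong monotonicity of [A] with respect to [H] bounds from below the cross
    term that is subtracted when the square of the norm is expanded. *)
Lemma forward_step_lip H A tau s r lam x y :
  0 <= lam -> 0 <= tau -> 0 <= s -> tau.-lipschitz H -> s.-lipschitz A ->
  strongly_monotone_wrt dot A H r ->
  `|(H x - lam *: A x) - (H y - lam *: A y)|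
    <= Num.sqrt (tau ^+ 2 - 2 * lam * r + lam ^+ 2 * s ^+ 2) * `|x - y|.
Proof.
move=> lam0 tau0 s0 /(_ (x, y)) /(_ (conj I I)) /= Hl.
move=> /(_ (x, y)) /(_ (conj I I)) /= Al /(_ x y) Amon.
have -> : (H x - lam *: A x) - (H y - lam *: A y)
    = (H x - H y) + (- lam) *: (A x - A y).
  by rewrite scaleNr scalerBr [- (H y - _)]opprD addrACA -opprD.
set w := (X in `|X|).
have sqr_le : `|w| ^+ 2
    <= (tau ^+ 2 - 2 * lam * r + lam ^+ 2 * s ^+ 2) * `|x - y| ^+ 2.
  rewrite /w sqr_normD (linearZr_LR _ (H x - H y))/= (dot_sym (H x - H y)).
  rewrite normrZ normrN (ger0_norm lam0).
  have {}Hl : `|H x - H y| ^+ 2 <= (tau * `|x - y|) ^+ 2.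
    by rewrite ler_pXn2r ?nnegrE ?mulr_ge0.
  have {}Al : `|A x - A y| ^+ 2 <= (s * `|x - y|) ^+ 2.
    by rewrite ler_pXn2r ?nnegrE ?mulr_ge0.
  have := ler_wpM2l (sqr_ge0 lam) Al; have := ler_wpM2l lam0 Amon.
  by rewrite !exprMn in Hl *; move=> h1 h2; lra.
have [xy0|xy0] := eqVneq `|x - y| 0.
  rewrite xy0 mulr0 -(@ler_pXn2r _ 2) ?nnegrE//.
  by apply: le_trans sqr_le _; rewrite xy0 expr0n/= mulr0.
have K0 : 0 <= tau ^+ 2 - 2 * lam * r + lam ^+ 2 * s ^+ 2.
  have xy2 : 0 < `|x - y| ^+ 2 by rewrite exprn_gt0// lt_def xy0/=.
  by rewrite -(pmulr_lge0 _ xy2); apply: le_trans sqr_le.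
rewrite -(@ler_pXn2r _ 2) ?nnegrE ?mulr_ge0 ?sqrtr_ge0//.
by rewrite exprMn sqr_sqrtr.
Qed.

(** The forward-backward map, whose fixed points are the solutions of
    [0 \in A u + M u]. *)
Definition forward_backward H A M lam u : V :=
  resolvent H M lam (H u - lam *: A u).

Lemma forward_backward_contraction H A M gamma tau s r eta lam x y :
  0 < gamma -> 0 < eta -> 0 < lam -> 0 <= tau -> 0 <= s ->
  strongly_monotone dot H gamma -> tau.-lipschitz H -> s.-lipschitz A ->
  strongly_monotone_wrt dot A H r -> strongly_H_monotone dot H M eta ->
  `|forward_backward H A M lam x - forward_backward H A M lam y|
    <= (gamma + lam * eta)^-1
       * Num.sqrt (tau ^+ 2 - 2 * lam * r + lam ^+ 2 * s ^+ 2) * `|x - y|.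
Proof.
move=> gamma0 eta0 lam0 tau0 s0 Hmon Hl Al Amon MH.
have g0 : 0 < gamma + lam * eta by rewrite addr_gt0// mulr_gt0.
rewrite -mulrA ler_pdivlMl//.
apply: le_trans (resolvent_lip _ _ lam0 Hmon MH) _.
exact: (forward_step_lip _ _ (ltW lam0)).
Qed.

Lemma forward_backward_fixed H A M gamma eta lam p :
  0 < gamma -> 0 < eta -> 0 < lam ->
  strongly_monotone dot H gamma -> strongly_H_monotone dot H M eta ->
  inclusion_solution A M p -> forward_backward H A M lam p = p.
Proof.
move=> gamma0 eta0 lam0 Hmon MH [x Mx Ax0].
apply: (resolvent_uniq gamma0 eta0 lam0 Hmon MH); exists x => //.
have -> : x = - A p by apply/eqP; rewrite -addr_eq0 addrC Ax0.
by rewrite scalerN.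
Qed.

(** * Averaged iterations of a contraction *)

Lemma norm_averageB a u z p : 0 <= a <= 1 ->
  `|(1 - a) *: u + a *: z - p| <= (1 - a) * `|u - p| + a * `|z - p|.
Proof.
move=> /andP[a0 a1].
have -> : (1 - a) *: u + a *: z - p = (1 - a) *: (u - p) + a *: (z - p).
  by rewrite !scalerBr addrACA -opprD -scalerDl subrK scale1r.
apply: le_trans (ler_normD _ _) _.
by rewrite !normrZ !ger0_norm// subr_ge0.
Qed.

Lemma norm_averageB_contraction F k a u p : 0 <= a <= 1 ->
  `|F u - p| <= k * `|u - p| ->
  `|(1 - a) *: u + a *: F u - p| <= (1 - a * (1 - k)) * `|u - p|.
Proof.
move=> a01 Fu; apply: le_trans (norm_averageB u (F u) p a01) _.
have /andP[a0 _] := a01; have := ler_wpM2l a0 Fu; lra.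
Qed.

End Contraction.

Theorem theorem2 (R : realType) (V : completeNormedModType R)
    (dot : {dot V for idfun}) (hdot : induces_norm dot)
    (H A : V -> V) (M : V -> set V) (gamma tau s r eta lam kappa : R)
    (hgamma : 0 < gamma) (htau : 0 < tau) (hs : 0 < s) (hr : 0 < r)
    (heta : 0 < eta) (hlam : 0 < lam)
    (H_smon : strongly_monotone dot H gamma) (H_lip : tau.-lipschitz H)
    (A_lip : s.-lipschitz A) (A_smon : strongly_monotone_wrt dot A H r)
    (M_neq0 : forall u, M u !=set0) (M_smon : strongly_H_monotone dot H M eta)
    (lam_bound :
       `|lam - (r + gamma * eta) / (s ^+ 2 - eta ^+ 2)|
       < Num.sqrt ((r + gamma * eta) ^+ 2
                   - (s ^+ 2 - eta ^+ 2) * (tau ^+ 2 - gamma ^+ 2))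
         / (s ^+ 2 - eta ^+ 2))
    (disc_gt0 : (s ^+ 2 - eta ^+ 2) * (tau ^+ 2 - gamma ^+ 2)
                < (r + gamma * eta) ^+ 2)
    (eta_lt_s : eta < s)
    (kappaE : kappa = (gamma + lam * eta)^-1
                      * Num.sqrt (tau ^+ 2 - 2 * lam * r + lam ^+ 2 * s ^+ 2))
    (xstar : V) (xstar_sol : inclusion_solution A M xstar)
    (xi_ mu_ : nat -> R)
    (xi01 : forall n, 0 <= xi_ n <= 1) (mu01 : forall n, 0 <= mu_ n <= 1)
    (sum_oo : series (fun n => xi_ n * mu_ n * (1 - kappa)) @ \oo --> +oo)
    (q_ r_ s_ t_ : nat -> V)
    (r_E : forall n, r_ n = (1 - mu_ n) *: q_ n
       + mu_ n *: resolvent H M lam (H (q_ n) - lam *: A (q_ n)))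
    (q_E : forall n, q_ n.+1 = (1 - xi_ n) *: q_ n
       + xi_ n *: resolvent H M lam (H (r_ n) - lam *: A (r_ n)))
    (t_E : forall n, t_ n = (1 - mu_ n) *: s_ n
       + mu_ n *: resolvent H M lam (H (s_ n) - lam *: A (s_ n)))
    (s_E : forall n, s_ n.+1 = resolvent H M lam (H (t_ n) - lam *: A (t_ n))) :
  q_ @ \oo --> xstar <-> s_ @ \oo --> xstar.
Proof.
pose F := forward_backward H A M lam.
have Flip u : `|F u - xstar| <= kappa * `|u - xstar|.
  have {1}<- : F xstar = xstar.
    exact: (forward_backward_fixed hgamma heta hlam H_smon M_smon).
  rewrite kappaE; apply: (forward_backward_contraction hdot) => //; exact: ltW.
have kappa1 : kappa < 1 by rewrite kappaE; exact: contraction_const_lt1.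
have kappa0 : 0 <= kappa.
  by rewrite kappaE mulr_ge0 ?sqrtr_ge0// invr_ge0 addr_ge0 ?mulr_ge0 ?ltW.
have Fnonexp u : `|F u - xstar| <= `|u - xstar|.
  by apply: le_trans (Flip u) _; rewrite ler_piMl// ltW.
pose c n := xi_ n * mu_ n * (1 - kappa).
have c0 n : 0 <= c n.
  have /andP[xi0 _] := xi01 n; have /andP[mu0 _] := mu01 n.
  by rewrite !mulr_ge0// subr_ge0 ltW.
have cvg_of_decrease (x_ : nat -> V) :
    (forall n, `|x_ n.+1 - xstar| <= (1 - c n) * `|x_ n - xstar|) ->
    x_ @ \oo --> xstar.
  move=> x_S; apply/subr_cvg0/norm_cvg0P.
  exact: (cvg0_of_divergent_decrease c0 _ x_S sum_oo).
suff [q_cvg s_cvg] : (q_ @ \oo --> xstar) /\ (s_ @ \oo --> xstar) by [].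
split; apply: cvg_of_decrease => n; have /andP[xi0 xi1] := xi01 n.
- have r_le : `|F (r_ n) - xstar| <= (1 - mu_ n * (1 - kappa)) * `|q_ n - xstar|.
    apply: le_trans (Fnonexp _) _; rewrite r_E.
    exact: norm_averageB_contraction (mu01 n) (Flip _).
  rewrite q_E; apply: le_trans (norm_averageB _ _ _ (xi01 n)) _.
  by have := ler_wpM2l xi0 r_le; rewrite /c; lra.
- rewrite s_E; apply: le_trans (Fnonexp _) _; rewrite t_E.
  apply: le_trans (norm_averageB_contraction (mu01 n) (Flip _)) _.
  (* only the weight [mu_ n] acts here, and [xi_ n <= 1] weakens it *)
  apply: ler_wpM2r => //; rewrite lerD2l lerN2 /c -mulrA.
  have /andP[mu0 _] := mu01 n.
  by rewrite ler_piMl// mulr_ge0// subr_ge0 ltW.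
Qed.
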